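(* For every integer $k>1$, let $h_k=\frac{3}{2}k^2-\frac{3}{2}k$ and $n_k=\frac{9}{2}k^2+\frac{3}{2}k-2$. Then $g_{\triangle}(h_k)=n_k$.
   Context: A polyiamond is a planar shape formed by gluing together finitely many congruent (closed) equilateral triangles (tiles) of the regular triangular lattice along their edges: any two tiles that intersect meet in an entire edge, and the union has connected interior. Polyiamonds are considered up to isometry. The number of tiles of a polyiamond $A$ is $|A|$. The number of holes $h(A)$ of $A$ is the number of bounded connected components of $\mathbb{R}^2\setminus A$. For $h\ge 1$, $g_{\triangle}(h)$ denotes the minimum of $|A|$ over all polyiamonds $A$ with $h(A)=h$. *)

(* Defs.v *)
From Stdlib Require Import ZArith List Relations.
Import ListNotations.
Open Scope Z_scope.

(* Lattice coordinates: the lattice point (x,y) is x*e1 + y*e2 with e1, e2 unit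
   vectors at 60 degrees.  Tiles (closed unit equilateral triangles):
   (x, y, false) = "up"   triangle with vertices (x,y), (x+1,y), (x,y+1);
   (x, y, true)  = "down" triangle with vertices (x+1,y), (x,y+1), (x+1,y+1).
   Every tile of the regular triangular lattice is exactly one of these. *)
Definition tri : Type := (Z * Z * bool)%type.

(* Edge-adjacency from an up triangle: its three edges are shared with
   the down triangles (x,y), (x-1,y), (x,y-1). *)
Definition adj_up (t u : tri) : Prop :=
  match t with
  | (x, y, false) =>
      u = (x, y, true) \/ u = (x - 1, y, true) \/ u = (x, y - 1, true)
  | _ => False
  end.

Definition adj (t u : tri) : Prop := adj_up t u \/ adj_up u t.

Definition conn (S : tri -> Prop) (t u : tri) : Prop :=
  S t /\ clos_refl_trans_1n tri (fun a b => S a /\ S b /\ adj a b) t u.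

(* A polyiamond: a nonempty finite set of tiles (duplicate-free list) whose
   union has connected interior, i.e. which is connected under edge-adjacency. *)
Definition polyiamond (A : list tri) : Prop :=
  A <> [] /\ NoDup A /\
  forall t u, In t A -> In u A -> conn (fun s => In s A) t u.

Definition card (A : list tri) : nat := length A.

Definition compl (A : list tri) (t : tri) : Prop := ~ In t A.

Definition bounded_comp (A : list tri) (t : tri) : Prop :=
  exists N : Z, forall x y b, conn (compl A) t (x, y, b) ->
    Z.abs x <= N /\ Z.abs y <= N.

(* h(A) = h: R^2 \ A has exactly h bounded connected components.  These are
   given by h representative tiles not in A, lying in pairwise distinct bounded
   components, such that every bounded component contains one of them. *)
Definition num_holes (A : list tri) (h : nat) : Prop :=
  exists reps : list tri,
    length reps = h /\
    (forall r, In r reps -> compl A r /\ bounded_comp A r) /\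
    ForallOrdPairs (fun r s => ~ conn (compl A) r s) reps /\
    (forall t, compl A t -> bounded_comp A t ->
       exists r, In r reps /\ conn (compl A) t r).

Definition g_triangle_eq (h n : nat) : Prop :=
  (exists A, polyiamond A /\ num_holes A h /\ card A = n) /\
  (forall A, polyiamond A -> num_holes A h -> (n <= card A)%nat).

(* Main.v *)
Require Import Defs.
From Stdlib Require Import Arith ZArith List Relations Lia Classical ClassicalEpsilon.
Import ListNotations.

(* Lower bound. Let [A] have [n] tiles and [h] holes. Of the [3 n] sides of its
   tiles at least [2 (n - 1)] face [A], by connectedness, and at least [3 h] face
   holes. The others bound the filling of [A], which has at least [n + h] tiles:
   if it meets [p], [q], [r] strips of the lattice in the three directions, both
   ends of each strip show that there are at least [s = p + q + r] such sides,
   while counting the tiles of a hexagon gives [6 (n + h) <= s^2]. Together,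
   [3 h + s <= n + 2] and [6 (n + h) <= s^2] force [n >= n_k] when [h = h_k].

   Upper bound. Surround a row of four tiles by concentric hexagonal rings and
   remove, in each ring, every other tile among those sharing a side with the
   previous ring. The [k - 1] rings contain [3 + 6 + ... + 3 (k - 1) = h_k]
   removed tiles out of the [6 k^2 - 2] tiles of the resulting hexagon. *)

(** * Counting in finite lists *)

Definition asbool (P : Prop) : bool :=
  if excluded_middle_informative P then true else false.

Lemma asbool_spec (P : Prop) : asbool P = true <-> P.
Proof.
  unfold asbool. destruct (excluded_middle_informative P); split; congruence || tauto.
Qed.

(** Deciding classically allows filtering by predicates such as lying in a bounded component. *)
Definition sub {T : Type} (P : T -> Prop) (l : list T) : list T :=
  filter (fun t => asbool (P t)) l.

Lemma in_sub {T : Type} (P : T -> Prop) l t : In t (sub P l) <-> In t l /\ P t.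
Proof. unfold sub. rewrite filter_In, asbool_spec. tauto. Qed.

Lemma NoDup_sub {T : Type} (P : T -> Prop) l : NoDup l -> NoDup (sub P l).
Proof. apply NoDup_filter. Qed.

Lemma sub_cons {T : Type} (P : T -> Prop) a l :
  (P a /\ sub P (a :: l) = a :: sub P l) \/ (~ P a /\ sub P (a :: l) = sub P l).
Proof.
  unfold sub. simpl. pose proof (asbool_spec (P a)).
  destruct (asbool (P a)); [left|right]; intuition congruence.
Qed.

Lemma length_sub_partition {T : Type} (P Q : T -> Prop) l :
  length (sub P l) =
  (length (sub (fun t => P t /\ Q t) l) + length (sub (fun t => P t /\ ~ Q t) l))%nat.
Proof.
  induction l as [|a l IH]; [reflexivity|].
  destruct (sub_cons P a l) as [[H1 ->]|[H1 ->]];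
  destruct (sub_cons (fun t => P t /\ Q t) a l) as [[H2 ->]|[H2 ->]];
  destruct (sub_cons (fun t => P t /\ ~ Q t) a l) as [[H3 ->]|[H3 ->]];
  simpl; tauto || lia.
Qed.

Lemma length_sub_mono {T : Type} (P Q : T -> Prop) l :
  (forall t, In t l -> P t -> Q t) -> (length (sub P l) <= length (sub Q l))%nat.
Proof.
  induction l as [|a l IH]; intros H; [reflexivity|].
  assert (IH' := IH (fun t h => H t (or_intror h))).
  assert (Ha := H a (or_introl eq_refl)).
  destruct (sub_cons P a l) as [[H1 ->]|[H1 ->]];
  destruct (sub_cons Q a l) as [[H2 ->]|[H2 ->]]; simpl; tauto || lia.
Qed.

Lemma length_sub_strict {T : Type} (P Q : T -> Prop) l x :
  (forall t, In t l -> P t -> Q t) -> In x l -> ~ P x -> Q x ->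
  (length (sub P l) < length (sub Q l))%nat.
Proof.
  intros H Hx HP HQ. induction l as [|a l IH]; [easy|].
  assert (Hl : forall t, In t l -> P t -> Q t) by (intros; apply H; simpl; auto).
  assert (Hm := length_sub_mono P Q l Hl).
  assert (Ha := H a (or_introl eq_refl)).
  destruct Hx as [->|Hx].
  - destruct (sub_cons P x l) as [[H1 ->]|[H1 ->]];
    destruct (sub_cons Q x l) as [[H2 ->]|[H2 ->]]; simpl; tauto || lia.
  - specialize (IH Hl Hx).
    destruct (sub_cons P a l) as [[H1 ->]|[H1 ->]];
    destruct (sub_cons Q a l) as [[H2 ->]|[H2 ->]]; simpl; tauto || lia.
Qed.

(** Pigeonhole for a relation, so that no image function has to be chosen; the induction removes
    from [M] one partner of the head of [L]. *)
Lemma length_le_of_injective_relation {S T : Type} (P : S -> T -> Prop) :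
  forall (L : list S) (M : list T), NoDup L ->
  (forall s, In s L -> exists t, In t M /\ P s t) ->
  (forall s s' t, In s L -> In s' L -> P s t -> P s' t -> s = s') ->
  (length L <= length M)%nat.
Proof.
  induction L as [|s L IH]; intros M HN Hex Hinj; simpl; [lia|].
  inversion_clear HN.
  destruct (Hex s (or_introl eq_refl)) as [t [Ht HP]].
  apply in_split in Ht. destruct Ht as [M1 [M2 ->]].
  enough (length L <= length (M1 ++ M2))%nat by (rewrite !length_app in *; simpl; lia).
  apply IH; auto.
  - intros s' Hs'. destruct (Hex s' (or_intror Hs')) as [t' [Ht' HP']].
    exists t'. split; auto. apply in_app_or in Ht'. apply in_or_app.
    destruct Ht' as [?|[<-|?]]; auto.
    exfalso. assert (s = s') by (apply (Hinj s s' t); simpl; auto). congruence.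
  - intros; eapply Hinj; simpl; eauto.
Qed.

Lemma NoDup_map_inj_in {S T : Type} (f : S -> T) l :
  (forall x y, In x l -> In y l -> f x = f y -> x = y) -> NoDup l -> NoDup (map f l).
Proof.
  intros Hf HN. induction HN as [|a l Ha HN IH]; simpl; constructor.
  - rewrite in_map_iff. intros [b [Hb Hbl]].
    assert (b = a) by (apply Hf; simpl; auto). congruence.
  - apply IH. intros; apply Hf; simpl; auto.
Qed.

(** Supplies the last tile of a walk that cannot leave a finite set. *)
Lemma exists_maximizer {T : Type} (pos : T -> Z) (Q : T -> Prop) l :
  (exists t, In t l /\ Q t) ->
  exists t, In t l /\ Q t /\ forall u, In u l -> Q u -> (pos u <= pos t)%Z.
Proof.
  induction l as [|a l IH]; intros [t [Ht HQ]]; [easy|].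
  destruct (classic (exists t, In t l /\ Q t)) as [Hl|Hl].
  - destruct (IH Hl) as [m [Hm [HQm Hmax]]].
    destruct (classic (Q a /\ (pos m <= pos a)%Z)) as [[HQa Hle]|Hn].
    + exists a. simpl. split; [auto|split; [auto|]].
      intros u [->|Hu] HQu; [lia|]. specialize (Hmax u Hu HQu). lia.
    + exists m. simpl. split; [auto|split; [auto|]].
      intros u [->|Hu] HQu; [|auto].
      destruct (Z_le_gt_dec (pos u) (pos m)); [auto|].
      exfalso. apply Hn. split; [auto|lia].
  - exists t. split; [auto|split; [auto|]].
    destruct Ht as [->|Ht]; [|exfalso; eauto].
    intros u [->|Hu] HQu; [lia|]. exfalso; eauto.
Qed.

Open Scope Z_scope.

Definition range (a n : Z) : list Z :=
  map (fun i => a + Z.of_nat i) (seq 0 (Z.to_nat n)).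

Lemma in_range a n v : In v (range a n) <-> a <= v < a + n.
Proof.
  unfold range. rewrite in_map_iff. split.
  - intros [i [<- Hi]]. apply in_seq in Hi. lia.
  - intros H. exists (Z.to_nat (v - a)). rewrite in_seq. lia.
Qed.

Lemma NoDup_range a n : NoDup (range a n).
Proof. apply NoDup_map_inj_in; [intros; lia|apply seq_NoDup]. Qed.

Lemma length_range a n : length (range a n) = Z.to_nat n.
Proof. unfold range. now rewrite length_map, length_seq. Qed.

Lemma NoDup_list_prod {S T : Type} (l : list S) (m : list T) :
  NoDup l -> NoDup m -> NoDup (list_prod l m).
Proof.
  intros Hl Hm. induction Hl as [|a l Ha Hl IH]; simpl; [constructor|].
  apply NoDup_app; auto.
  - apply NoDup_map_inj_in; [congruence|auto].
  - intros [s t] H1 H2. apply in_map_iff in H1. destruct H1 as [? [[= <- <-] _]].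
    apply in_prod_iff in H2. tauto.
Qed.

(** * Adjacency, coordinates and connectivity *)

Inductive dir : Type := D0 | D1 | D2.

(** Naming the sides of a tile by direction makes each [nb d] an involution, so an edge can be
    counted from either of its two tiles. *)
Definition nb (d : dir) (t : tri) : tri :=
  let '(x, y, b) := t in
  match d with
  | D0 => (x, y, negb b)
  | D1 => if b then (x + 1, y, false) else (x - 1, y, true)
  | D2 => if b then (x, y + 1, false) else (x, y - 1, true)
  end.

(* The index of the strip, in each of the three directions, containing a tile:
   [nb d] changes [co d] by one and preserves the other two indices. *)
Definition co (d : dir) (t : tri) : Z :=
  let '(x, y, b) := t in
  match d with D0 => x + y + (if b then 1 else 0) | D1 => x | D2 => y end.

Definition box (x0 p y0 q : Z) : list tri :=
  list_prod (list_prod (range x0 p) (range y0 q)) [false; true].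

Lemma in_box x0 p y0 q t :
  x0 <= co D1 t < x0 + p -> y0 <= co D2 t < y0 + q -> In t (box x0 p y0 q).
Proof.
  destruct t as [[x y] b]. cbn [co]. intros Hx Hy.
  apply in_prod; [apply in_prod; now apply in_range|]. destruct b; simpl; auto.
Qed.

Lemma NoDup_box x0 p y0 q : NoDup (box x0 p y0 q).
Proof.
  apply NoDup_list_prod; [apply NoDup_list_prod; apply NoDup_range|].
  repeat constructor; simpl; intuition congruence.
Qed.

Lemma length_box x0 p y0 q : length (box x0 p y0 q) = (Z.to_nat p * Z.to_nat q * 2)%nat.
Proof.
  transitivity (length (list_prod (range x0 p) (range y0 q)) * 2)%nat; [apply length_prod|].
  now rewrite length_prod, !length_range.
Qed.

Ltac tri_eq := repeat f_equal; lia.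

Lemma nb_involutive d t : nb d (nb d t) = t.
Proof. destruct t as [[x y] []], d; simpl; tri_eq. Qed.

Lemma adj_iff_nb t u : adj t u <-> exists d, u = nb d t.
Proof.
  destruct t as [[x y] b], u as [[x' y'] b']. unfold adj, adj_up. split.
  - destruct b, b'; intros [H|H]; try easy;
      try (destruct H as [H|[H|H]]; try easy; inversion H; subst);
      [exists D0|exists D1|exists D2|exists D0|exists D1|exists D2]; simpl; tri_eq.
  - intros [[] H]; destruct b; simpl in H; inversion H; subst;
      [right; left|left; left|right; right; left|left; right; left
      |right; right; right|left; right; right]; tri_eq.
Qed.

Lemma co_nb_other c d t : d <> c -> co c (nb d t) = co c t.
Proof. destruct t as [[x y] []], c, d; simpl; intros; try easy; lia. Qed.

Lemma co_nb_near c d t : Z.abs (co c (nb d t) - co c t) <= 1.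
Proof. destruct t as [[x y] []], c, d; simpl; lia. Qed.

Lemma conn_refl S t : S t -> conn S t t.
Proof. split; [auto|constructor]. Qed.

Lemma conn_holds_end S t u : conn S t u -> S u.
Proof. intros [H1 H2]. induction H2 as [|? ? ? [? [? ?]] ? IH]; auto. Qed.

Lemma conn_trans S t u v : conn S t u -> conn S u v -> conn S t v.
Proof.
  intros [H1 H2] [_ H4]. split; [auto|].
  apply clos_rt_rt1n. eapply rt_trans; apply clos_rt1n_rt; eassumption.
Qed.

Lemma conn_nb (S : tri -> Prop) d t : S t -> S (nb d t) -> conn S t (nb d t).
Proof.
  intros H1 H2. split; [auto|]. econstructor; [|constructor].
  repeat split; auto. apply adj_iff_nb. eauto.
Qed.

Lemma conn_nb_r (S : tri -> Prop) d t u : conn S t u -> S (nb d u) -> conn S t (nb d u).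
Proof.
  intros H1 H2. eapply conn_trans; [eassumption|].
  apply conn_nb; [eapply conn_holds_end; eassumption|auto].
Qed.

Lemma conn_invariant (S : tri -> Prop) (Q : tri -> Prop) t u :
  (forall v d, S v -> S (nb d v) -> Q v -> Q (nb d v)) ->
  conn S t u -> Q t -> Q u.
Proof.
  intros HQ [_ H]. induction H as [|a b c [Ha [Hb Hab]] _ IH]; auto.
  intros HQa. apply IH. apply adj_iff_nb in Hab. destruct Hab as [d ->]. auto.
Qed.

Lemma conn_sym S t u : conn S t u -> conn S u t.
Proof.
  intros H. eapply (conn_invariant S (fun v => conn S v t)); eauto.
  - intros v d Hv Hd Hc. eapply conn_trans; [|exact Hc].
    rewrite <- (nb_involutive d v) at 2. apply conn_nb; [auto|].
    now rewrite nb_involutive.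
  - apply conn_refl, H.
Qed.

Lemma conn_mono (S S' : tri -> Prop) t u : (forall v, S v -> S' v) -> conn S t u -> conn S' t u.
Proof.
  intros HS Hc. apply (conn_invariant S (conn S' t) t u); auto.
  - intros v d _ Hd Hv. apply conn_nb_r; auto.
  - apply conn_refl, HS, Hc.
Qed.

(** A step changes [co c] by at most one, so a path cannot jump over the strip [v]. *)
Lemma conn_intermediate_value (S : tri -> Prop) c t u v :
  conn S t u -> co c t <= v <= co c u -> exists w, S w /\ co c w = v.
Proof.
  intros Hc Hv. apply NNPP. intros Hn.
  assert (co c u < v); [|lia].
  pose proof (fun w Hw e => Hn (ex_intro _ w (conj Hw e))) as Hne.
  apply (conn_invariant S (fun w => co c w < v) t u); auto.
  - intros w d Hw Hd Hlt. specialize (Hne _ Hd). pose proof (co_nb_near c d w). lia.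
  - specialize (Hne t (proj1 Hc)). lia.
Qed.

Lemma conn_leaves (S Q : tri -> Prop) t u : conn S t u -> Q t -> ~ Q u ->
  exists v d, S v /\ S (nb d v) /\ Q v /\ ~ Q (nb d v).
Proof.
  intros Hc Ht Hu. apply NNPP. intros Hn. apply Hu.
  apply (conn_invariant S Q t u); auto. intros v d Hv Hd HQ.
  apply NNPP. intros HQ'. apply Hn. now exists v, d.
Qed.

(** * Boundary edges *)

Definition isdown (t : tri) : Prop := snd t = true.

Definition zigzag (d d' : dir) (t : tri) : tri := if snd t then nb d' t else nb d t.

(* Alternating between two directions moves monotonically along a strip. *)
Lemma zigzag_monotone d d' : d <> d' ->
  exists pos : tri -> Z, forall t, pos t < pos (zigzag d d' t).
Proof.
  (* Doubling leaves room for the orientation, so that a step between two tiles with the same [x]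
     and [y] counts too. *)
  pose (px := fun t : tri => let '(x, y, b) := t in 2 * x + (if b : bool then 1 else 0)).
  pose (py := fun t : tri => let '(x, y, b) := t in 2 * y + (if b : bool then 1 else 0)).
  intros Hd.
  destruct d, d'; try easy;
    [exists px|exists py|exists (fun t => - px t)|exists py
    |exists (fun t => - py t)|exists (fun t => - py t)];
    intros [[x y] []]; unfold px, py, zigzag; cbn [snd nb negb]; lia.
Qed.

(** The share of direction [d] in the perimeter of [X]. *)
Definition bd (d : dir) (X : list tri) : nat :=
  length (sub (fun t => ~ In (nb d t) X) X).

(** In each class take the tile farthest along the zigzag. Its next step leaves [X], since the class
    is closed under steps inside [X]. The relation [P] is left abstract in order to cover both holes
    and strips. *)
Lemma zigzag_exits (S : Type) (X : list tri) (L : list S) (P : S -> tri -> Prop) d d' :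
  d <> d' -> NoDup L ->
  (forall s, In s L -> exists t, In t X /\ P s t) ->
  (forall s s' t, In s L -> In s' L -> P s t -> P s' t -> s = s') ->
  (forall e s t, e = d \/ e = d' -> In t X -> In (nb e t) X -> P s t -> P s (nb e t)) ->
  (length L <=
   length (sub (fun t => ~ In (nb d t) X /\ ~ isdown t) X) +
   length (sub (fun t => ~ In (nb d' t) X /\ isdown t) X))%nat.
Proof.
  intros Hd HN Hex Hinj Hcl.
  destruct (zigzag_monotone d d' Hd) as [pos Hpos].
  apply Nat.le_trans with (length (sub (fun t => ~ In (zigzag d d' t) X) X)).
  - apply (length_le_of_injective_relation P); auto.
    intros s Hs. destruct (exists_maximizer pos (P s) X (Hex s Hs)) as [t [Ht [HP Hmax]]].
    exists t. split; [|auto]. apply in_sub. split; [auto|]. intros Hin.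
    enough (pos (zigzag d d' t) <= pos t) by (specialize (Hpos t); lia).
    apply Hmax; auto. revert Hin. unfold zigzag. destruct (snd t); intros; apply Hcl; auto.
  - rewrite (length_sub_partition _ isdown), Nat.add_comm.
    apply Nat.add_le_mono; apply length_sub_mono; intros [[x y] []] _;
      unfold isdown, zigzag; simpl; tauto || intuition congruence.
Qed.

Lemma bd_split d X :
  bd d X = (length (sub (fun t => ~ In (nb d t) X /\ isdown t) X) +
            length (sub (fun t => ~ In (nb d t) X /\ ~ isdown t) X))%nat.
Proof. apply length_sub_partition. Qed.

(* Each class [s] of [L c] meets a strip in direction [c], at whose two ends
   there are boundary edges crossed in the other two directions; every edge
   is counted in two of the three directions. *)
Lemma boundary_ge (S : Type) (X : list tri) (L : dir -> list S)
    (P : dir -> S -> tri -> Prop) :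
  (forall c, NoDup (L c)) ->
  (forall c s, In s (L c) -> exists t, In t X /\ P c s t) ->
  (forall c s s' t, In s (L c) -> In s' (L c) -> P c s t -> P c s' t -> s = s') ->
  (forall c d s t, d <> c -> In t X -> In (nb d t) X -> P c s t -> P c s (nb d t)) ->
  (length (L D0) + length (L D1) + length (L D2) <= bd D0 X + bd D1 X + bd D2 X)%nat.
Proof.
  intros HN Hex Hinj Hcl.
  assert (H : forall c d d', d <> d' -> d <> c -> d' <> c -> (length (L c) <=
     length (sub (fun t => ~ In (nb d t) X /\ ~ isdown t) X) +
     length (sub (fun t => ~ In (nb d' t) X /\ isdown t) X))%nat).
  { intros c d d' Hd Hc Hc'.
    apply (zigzag_exits S X (L c) (P c) d d'); eauto.
    intros e s t [->| ->]; auto. }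
  (* Exchanging [d] and [d'] reverses the walk and reaches the other end of the strip. Each term, a
     direction with an orientation, occurs twice in the six bounds, whose sum is therefore twice the
     claim. *)
  rewrite !bd_split.
  assert (H1 := H D0 D1 D2). assert (H2 := H D0 D2 D1).
  assert (H3 := H D1 D0 D2). assert (H4 := H D1 D2 D0).
  assert (H5 := H D2 D0 D1). assert (H6 := H D2 D1 D0).
  clear - H1 H2 H3 H4 H5 H6.
  repeat match goal with H : _ -> _ |- _ => specialize (H ltac:(discriminate)) end.
  lia.
Qed.

(** Each edge between two tiles of [X] is counted twice, once from either side. *)
Definition inner (d : dir) (X : list tri) : nat :=
  length (sub (fun t => In (nb d t) X) X).

Lemma inner_cons d0 X u : ~ In u X -> In (nb d0 u) X ->
  (inner D0 X + inner D1 X + inner D2 X + 2 <=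
   inner D0 (u :: X) + inner D1 (u :: X) + inner D2 (u :: X))%nat.
Proof.
  intros Hu Hd.
  assert (Hle : forall d, (inner d X <= inner d (u :: X))%nat).
  { intros d. unfold inner. apply Nat.le_trans with (length (sub (fun t => In (nb d t) (u :: X)) X)).
    - apply length_sub_mono. simpl. auto.
    - destruct (sub_cons (fun t => In (nb d t) (u :: X)) u X) as [[_ ->]|[_ ->]]; cbn [length]; lia. }
  assert (H2 : (inner d0 X + 2 <= inner d0 (u :: X))%nat).
  { unfold inner.
    destruct (sub_cons (fun t => In (nb d0 t) (u :: X)) u X) as [[_ ->]|[H _]].
    - cbn [length].
      enough (length (sub (fun t => In (nb d0 t) X) X) <
              length (sub (fun t => In (nb d0 t) (u :: X)) X))%nat by lia.
      apply length_sub_strict with (nb d0 u); simpl; rewrite ?nb_involutive; auto.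
    - exfalso. apply H. simpl. auto. }
  assert (H0 := Hle D0). assert (H1 := Hle D1). assert (H3 := Hle D2).
  destruct d0; lia.
Qed.

Lemma NoDup_incl_equal {T : Type} (X Y : list T) :
  NoDup X -> incl X Y -> length X = length Y -> incl Y X.
Proof. intros. apply NoDup_length_incl; auto. lia. Qed.

(** Grows a spanning tree: as long as tiles are missing, some path in [A] leaves [X], and the tile
    where it does so brings a new edge, counted from both sides. *)
Lemma inner_grow A m : polyiamond A -> (1 <= m <= length A)%nat ->
  exists X, NoDup X /\ incl X A /\ length X = m /\
    (2 * m <= inner D0 X + inner D1 X + inner D2 X + 2)%nat.
Proof.
  intros [Hne [HN Hc]]. induction m as [|m IH]; intros Hm; [lia|].
  destruct m as [|m].
  - destruct A as [|a A]; [easy|]. exists [a]. simpl. repeat split; try lia.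
    + repeat constructor. easy.
    + intros t [->|[]]. simpl; auto.
  - destruct IH as [X [HX [HXA [HXm Hi]]]]; [lia|].
    assert (Hw : exists w, In w A /\ ~ In w X).
    { apply NNPP. intros Hn. enough (length A <= length X)%nat by lia.
      apply NoDup_incl_length; auto. intros w Hw. apply NNPP. eauto. }
    destruct Hw as [w [HwA HwX]].
    destruct X as [|x X']; [simpl in HXm; lia|]. set (X := x :: X') in *.
    assert (Hx : In x X) by (simpl; auto).
    destruct (conn_leaves _ (fun t => In t X) x w (Hc x w (HXA x Hx) HwA) Hx HwX)
      as [v [d [Hv [Hvd [HvX HdX]]]]].
    exists (nb d v :: X). repeat split.
    + constructor; auto.
    + intros t [<-|Ht]; auto.
    + simpl. simpl in HXm. lia.
    + pose proof (inner_cons d X (nb d v) HdX). rewrite nb_involutive in H.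
      specialize (H HvX). lia.
Qed.

Lemma inner_connected A : polyiamond A ->
  (2 * length A <= inner D0 A + inner D1 A + inner D2 A + 2)%nat.
Proof.
  intros HA. destruct (inner_grow A (length A) HA) as [X [HX [HXA [Hl Hi]]]].
  - destruct HA as [Hne _]. destruct A; [easy|]. simpl; lia.
  - assert (HAX : incl A X) by (apply NoDup_incl_equal; auto).
    assert (HN : NoDup A) by apply HA.
    enough (forall d, (inner d X <= inner d A)%nat) as H
      by (pose proof (H D0); pose proof (H D1); pose proof (H D2); lia).
    intros d. unfold inner. apply NoDup_incl_length; [now apply NoDup_sub|].
    intros t. rewrite !in_sub. intros [? ?]. auto.
Qed.

(** * The isoperimetric inequality *)

(* A bijection from the square [0,i)^2 onto the [i^2] tiles of the triangle
   of side [i] with corner at the origin. *)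
Definition corner (i : Z) (uv : Z * Z) : tri :=
  let '(u, v) := uv in
  if u + v <? i then (u, v, false) else (i - 1 - u, i - 1 - v, true).

Definition place (x0 y0 : Z) (t : tri) : tri :=
  let '(x, y, b) := t in (x0 + x, y0 + y, b).

(** A half-turn, which exchanges up and down tiles; it carries a corner of the parallelogram to the
    opposite one. *)
Definition place_opp (x0 y0 : Z) (t : tri) : tri :=
  let '(x, y, b) := t in (x0 - x, y0 - y, negb b).

Definition square (i : Z) : list (Z * Z) := list_prod (range 0 i) (range 0 i).

(* A hexagon with extents [p], [q], [r] is a [p] by [q] parallelogram of [2pq]
   tiles with two corners of sides [i] and [j] cut off. *)
Lemma hexagon_count (F : list tri) x0 y0 z0 p q r i j :
  NoDup F ->
  (forall t, In t F -> x0 <= co D1 t < x0 + p /\ y0 <= co D2 t < y0 + q /\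
                       z0 <= co D0 t < z0 + r) ->
  z0 = x0 + y0 + i -> x0 + y0 + p + q = z0 + r + j ->
  0 <= r -> 0 <= i <= p -> i <= q -> 0 <= j <= p -> j <= q ->
  Z.of_nat (length F) + i * i + j * j <= 2 * p * q.
Proof.
  intros HN HF Hi Hj Hr Hip Hiq Hjp Hjq.
  (* In direction [D0], [C1] lies in strips below [z0] and [C2] in strips from [z0 + r] on, so [F],
     [C1] and [C2] are disjoint. *)
  set (C1 := map (fun uv => place x0 y0 (corner i uv)) (square i)).
  set (C2 := map (fun uv => place_opp (x0 + p - 1) (y0 + q - 1) (corner j uv)) (square j)).
  set (Box := box x0 p y0 q).
  assert (Hsq : forall k, NoDup (square k))
    by (intro; apply NoDup_list_prod; apply NoDup_range).
  assert (Hle : (length (F ++ C1 ++ C2) <= length Box)%nat).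
  { apply NoDup_incl_length.
    - repeat apply NoDup_app; auto.
      + apply NoDup_map_inj_in; auto. intros [u v] [u' v'] H1 H2.
        apply in_prod_iff in H1. apply in_prod_iff in H2. rewrite !in_range in *.
        unfold place, corner.
        destruct (Z.ltb_spec (u + v) i), (Z.ltb_spec (u' + v') i); intros [=]; f_equal; lia.
      + apply NoDup_map_inj_in; auto. intros [u v] [u' v'] H1 H2.
        apply in_prod_iff in H1. apply in_prod_iff in H2. rewrite !in_range in *.
        unfold place_opp, corner.
        destruct (Z.ltb_spec (u + v) j), (Z.ltb_spec (u' + v') j); intros [=]; f_equal; lia.
      + intros t H1 H2. apply in_map_iff in H1. apply in_map_iff in H2.
        destruct H1 as [[u v] [<- H1]], H2 as [[u' v'] [He H2]].
        apply in_prod_iff in H1. apply in_prod_iff in H2. rewrite !in_range in *.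
        revert He. unfold place, place_opp, corner.
        destruct (Z.ltb_spec (u + v) i), (Z.ltb_spec (u' + v') j); intros [=]; lia.
      + intros t H1 H2. specialize (HF t H1). apply in_app_or in H2.
        destruct H2 as [H2|H2]; apply in_map_iff in H2; destruct H2 as [[u v] [He H2]];
          apply in_prod_iff in H2; rewrite !in_range in H2; subst t; revert HF;
          unfold place, place_opp, corner.
        * destruct (Z.ltb_spec (u + v) i); simpl; lia.
        * destruct (Z.ltb_spec (u + v) j); simpl; lia.
    - intros t Ht. apply in_box.
      all: apply in_app_or in Ht; destruct Ht as [Ht|Ht]; [apply (HF t Ht)|].
      all: apply in_app_or in Ht; destruct Ht as [Ht|Ht]; apply in_map_iff in Ht;
           destruct Ht as [[u v] [<- H2]];
           apply in_prod_iff in H2; rewrite !in_range in H2; unfold place, place_opp, corner;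
           destruct (Z.ltb_spec (u + v) i), (Z.ltb_spec (u + v) j); simpl; lia. }
  unfold C1, C2, Box, square in Hle.
  rewrite length_box, !length_app, !length_map, !length_prod, !length_range in Hle.
  nia.
Qed.

(** After eliminating [r], the difference [(p + q + r)^2 - 6 (2 p q - i^2 - j^2)] equals [(p + q - 2
    (i + j))^2 + 3 (p - q)^2 + 3 (i - j)^2]. *)
Lemma isoperimetric_arith f p q r i j :
  i + j = p + q - r -> f + i * i + j * j <= 2 * p * q ->
  6 * f <= (p + q + r) * (p + q + r).
Proof.
  intros H1 H2. replace r with (p + q - i - j) by lia.
  pose proof (Z.square_nonneg (p + q - 2 * (i + j))).
  pose proof (Z.square_nonneg (p - q)).
  pose proof (Z.square_nonneg (i - j)).
  nia.
Qed.

(** Connectedness leaves no gap between the lowest and the highest strip met. *)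
Lemma extent A c : polyiamond A ->
  exists lo n, 0 < n /\ (forall t, In t A -> lo <= co c t < lo + n) /\
    (forall v, lo <= v < lo + n -> exists t, In t A /\ co c t = v).
Proof.
  intros [Hne [_ Hc]].
  assert (Hex : exists t, In t A /\ True) by (destruct A as [|a A]; [easy|exists a; simpl; auto]).
  destruct (exists_maximizer (co c) _ A Hex) as [u [Hu [_ Hmax]]].
  destruct (exists_maximizer (fun t => - co c t) _ A Hex) as [t [Ht [_ Hmin]]].
  exists (co c t), (co c u - co c t + 1).
  split; [|split].
  - specialize (Hmax t Ht I). lia.
  - intros w Hw. specialize (Hmax w Hw I). specialize (Hmin w Hw I). simpl in Hmin. lia.
  - intros v Hv. apply (conn_intermediate_value _ c t u v); [auto|lia].
Qed.

(** * Filling the holes, and the lower bound *)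

Lemma bounded_comp_conn A t u : conn (compl A) t u -> bounded_comp A t -> bounded_comp A u.
Proof.
  intros Hc [N HN]. exists N. intros x y b H. apply (HN x y b). eapply conn_trans; eauto.
Qed.

(** Finitely many bounded components have a common bound, so one box contains all their tiles. *)
Lemma hole_tiles A h : num_holes A h ->
  exists H, NoDup H /\ forall t, In t H <-> compl A t /\ bounded_comp A t.
Proof.
  intros [reps [_ [Hr [_ Hall]]]].
  assert (HN : exists N, forall r, In r reps -> forall x y b, conn (compl A) r (x, y, b) ->
    Z.abs x <= N /\ Z.abs y <= N).
  { clear Hall. induction reps as [|r reps IH]; [exists 0; easy|].
    destruct IH as [N HN]; [intros; apply Hr; simpl; auto|].
    destruct (Hr r (or_introl eq_refl)) as [_ [N' HN']].
    exists (Z.max N N'). intros r' [<-|Hr'] x y b Hc.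
    - specialize (HN' _ _ _ Hc). lia.
    - specialize (HN _ Hr' _ _ _ Hc). lia. }
  destruct HN as [N HN].
  set (Box := box (- N) (2 * N + 1) (- N) (2 * N + 1)).
  exists (sub (fun t => compl A t /\ bounded_comp A t) Box). split.
  - apply NoDup_sub, NoDup_box.
  - intros t. rewrite in_sub. split; [tauto|]. intros [H1 H2]. split; [|auto].
    destruct (Hall t H1 H2) as [r [Hin Hc]]. apply conn_sym in Hc.
    destruct t as [[x y] b]. specialize (HN r Hin x y b Hc).
    apply in_box; cbn [co]; lia.
Qed.

(** A neighbour of a tile of [H] is in [A] or in [H], so only tiles of [A] contribute to the
    perimeter of the filling. *)
Lemma bd_fill A H d :
  (forall t, In t H -> compl A (nb d t) -> In (nb d t) H) ->
  bd d (A ++ H) = length (sub (fun t => ~ In (nb d t) (A ++ H)) A).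
Proof.
  intros HH. unfold bd. unfold sub at 1. rewrite filter_app, length_app.
  fold (sub (fun t => ~ In (nb d t) (A ++ H)) A).
  fold (sub (fun t => ~ In (nb d t) (A ++ H)) H).
  destruct (sub (fun t => ~ In (nb d t) (A ++ H)) H) as [|t l] eqn:E; [simpl; lia|].
  exfalso. assert (Ht : In t (sub (fun t => ~ In (nb d t) (A ++ H)) H)) by (rewrite E; simpl; auto).
  apply in_sub in Ht. destruct Ht as [Ht Hn]. rewrite in_app_iff in Hn.
  apply Hn. right. apply HH; auto. intro; auto.
Qed.

(* Each of the three sides of a tile of [A] faces [A], a hole or the outside. *)
Lemma sides_partition A H d :
  NoDup H -> (forall t, In t H -> ~ In t A) ->
  (forall t, In t H -> compl A (nb d t) -> In (nb d t) H) ->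
  (inner d A + bd d H + bd d (A ++ H) <= length A)%nat.
Proof.
  intros HN Hdis HH. rewrite bd_fill by auto. unfold inner.
  assert (HA : length A = length (sub (fun _ => True) A)).
  { clear. induction A as [|a A IH]; [auto|].
    destruct (sub_cons (fun _ => True) a A) as [[_ ->]|[? _]]; simpl; tauto || lia. }
  rewrite HA, (length_sub_partition (fun _ => True) (fun t => In (nb d t) A)).
  rewrite (length_sub_partition (fun t => True /\ ~ In (nb d t) A) (fun t => In (nb d t) H)).
  rewrite <- Nat.add_assoc. apply Nat.add_le_mono; [|apply Nat.add_le_mono].
  - apply length_sub_mono; auto.
  (* [bd d H] counts these edges from the side of the hole; [nb d] passes to the side of [A]. *)
  - apply (length_le_of_injective_relation (fun s t => t = nb d s)).
    + now apply NoDup_sub.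
    + intros s Hs. apply in_sub in Hs. destruct Hs as [Hs Hn]. exists (nb d s).
      split; [|auto]. apply in_sub. rewrite nb_involutive. repeat split; auto.
      apply NNPP. intro. apply Hn. auto.
    + intros s s' t _ _ -> E. rewrite <- (nb_involutive d s), E. apply nb_involutive.
  - apply length_sub_mono. intros t _. rewrite in_app_iff. tauto.
Qed.

Lemma polyiamond_bound A h : polyiamond A -> num_holes A h ->
  exists s, 0 <= s /\ 3 * Z.of_nat h + s <= Z.of_nat (length A) + 2 /\
    6 * (Z.of_nat (length A) + Z.of_nat h) <= s * s.
Proof.
  intros HA Hh. destruct (hole_tiles A h Hh) as [H [HN HH]].
  destruct Hh as [reps [Hlen [Hreps [Hpair Hall]]]].
  assert (Hdis : forall t, In t H -> ~ In t A) by (intros t Ht; apply HH in Ht; apply Ht).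
  assert (Hcl : forall d t, In t H -> compl A (nb d t) -> In (nb d t) H).
  { intros d t Ht Hc. apply HH in Ht. apply HH. split; [auto|].
    eapply bounded_comp_conn; [|apply Ht]. apply conn_nb; tauto. }
  assert (HNreps : NoDup reps).
  { clear - Hpair Hreps. induction Hpair as [|r l Hr _ IH]; constructor.
    - intros Hin. rewrite Forall_forall in Hr. apply (Hr r Hin). apply conn_refl.
      apply Hreps. simpl; auto.
    - apply IH. intros; apply Hreps; simpl; auto. }
  assert (Hsep : forall r s, In r reps -> In s reps -> conn (compl A) r s -> r = s).
  { clear - Hpair. induction Hpair as [|a l Ha _ IH]; intros r s; simpl; [tauto|].
    rewrite Forall_forall in Ha.
    intros [<-|Hr] [<-|Hs] Hc; auto; exfalso.
    - eapply Ha; eauto.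
    - eapply Ha; eauto. now apply conn_sym. }
  (* For all three directions the classes are the holes, which gives three edges per hole. *)
  assert (Hhole : (h + h + h <= bd D0 H + bd D1 H + bd D2 H)%nat).
  { subst h. apply (boundary_ge tri H (fun _ => reps) (fun _ => conn (compl A))); auto.
    - intros _ r Hr. exists r. split; [apply HH|apply conn_refl]; apply Hreps; auto.
    - intros _ r s t Hr Hs Hc1 Hc2. apply Hsep; auto. eapply conn_trans; eauto.
      now apply conn_sym.
    - intros _ d r t _ Ht Htd Hc. eapply conn_nb_r; eauto. apply HH; auto. }
  (* Filling does not enlarge the extents: walking along a strip from a hole, one runs into [A]. *)
  assert (Hproj : forall c t, In t (A ++ H) -> exists u, In u A /\ co c u = co c t).
  { intros c t Ht. apply in_app_or in Ht. destruct Ht as [Ht|Ht]; [eauto|].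
    apply NNPP. intros Hn.
    assert (Hd : exists d d' : dir, d <> d' /\ d <> c /\ d' <> c).
    { destruct c; [exists D1, D2|exists D0, D2|exists D0, D1]; repeat split; discriminate. }
    destruct Hd as [d [d' [Hd [Hdc Hdc']]]].
    destruct (zigzag_monotone d d' Hd) as [pos Hpos].
    destruct (exists_maximizer pos (fun u => co c u = co c t) H) as [u [Hu [Hcu Hmax]]]; [eauto|].
    assert (Hz : In (zigzag d d' u) H -> False).
    { intros Hz. specialize (Hpos u). specialize (Hmax _ Hz).
      enough (co c (zigzag d d' u) = co c t) by (specialize (Hmax H0); lia).
      rewrite <- Hcu. unfold zigzag. destruct (snd u); apply co_nb_other; auto. }
    apply Hn. exists (zigzag d d' u). split.
    - apply NNPP. intros HzA. apply Hz. unfold zigzag in *. destruct (snd u); apply Hcl; auto.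
    - rewrite <- Hcu. unfold zigzag. destruct (snd u); apply co_nb_other; auto. }
  destruct (extent A D1 HA) as [x0 [p [Hp [Hx Hx']]]].
  destruct (extent A D2 HA) as [y0 [q [Hq [Hy Hy']]]].
  destruct (extent A D0 HA) as [z0 [r [Hr [Hz Hz']]]].
  set (L := fun c => match c with D0 => range z0 r | D1 => range x0 p | D2 => range y0 q end).
  assert (Hout : (length (L D0) + length (L D1) + length (L D2) <=
                  bd D0 (A ++ H) + bd D1 (A ++ H) + bd D2 (A ++ H))%nat).
  { apply (boundary_ge Z (A ++ H) L (fun c s t => co c t = s)).
    - intros []; apply NoDup_range.
    - intros c s Hs. enough (exists t, In t A /\ co c t = s) as [t [? ?]]
        by (exists t; rewrite in_app_iff; auto).
      destruct c; apply in_range in Hs; auto.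
    - congruence.
    - intros c d s t Hd _ _ <-. now apply co_nb_other. }
  cbn [L] in Hout. rewrite !length_range in Hout.
  exists (p + q + r). split; [lia|]. split.
  (* Summed over the directions, the sides give [(2 n - 2) + 3 h + s <= 3 n]. *)
  - pose proof (inner_connected A HA).
    pose proof (sides_partition A H D0 HN Hdis (Hcl D0)).
    pose proof (sides_partition A H D1 HN Hdis (Hcl D1)).
    pose proof (sides_partition A H D2 HN Hdis (Hcl D2)). lia.
  - assert (Hc : Z.of_nat (length (A ++ H)) + (z0 - x0 - y0) * (z0 - x0 - y0) +
        (x0 + y0 + p + q - z0 - r) * (x0 + y0 + p + q - z0 - r) <= 2 * p * q).
    { assert (Hcz : forall t, exists e, 0 <= e <= 1 /\ co D0 t = co D1 t + co D2 t + e).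
      { intros [[x y] b]. exists (if b then 1 else 0). destruct b; simpl; lia. }
      assert (Hbox : forall t, In t A -> x0 <= co D1 t < x0 + p /\ y0 <= co D2 t < y0 + q /\
        z0 <= co D0 t < z0 + r) by auto.
      (* Tiles in the extreme strips bound the sides of the two cut corners: [t5] and [t6] make them
         nonnegative, the other four make them at most [p] and [q]. *)
      destruct (Hx' x0) as [t1 [A1 E1]]; [lia|]. destruct (Hx' (x0 + p - 1)) as [t2 [A2 E2]]; [lia|].
      destruct (Hy' y0) as [t3 [A3 E3]]; [lia|]. destruct (Hy' (y0 + q - 1)) as [t4 [A4 E4]]; [lia|].
      destruct (Hz' z0) as [t5 [A5 E5]]; [lia|]. destruct (Hz' (z0 + r - 1)) as [t6 [A6 E6]]; [lia|].
      assert (B1 := Hbox _ A1). assert (B2 := Hbox _ A2). assert (B3 := Hbox _ A3).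
      assert (B4 := Hbox _ A4). assert (B5 := Hbox _ A5). assert (B6 := Hbox _ A6).
      destruct (Hcz t1) as [? [? C1]], (Hcz t2) as [? [? C2]], (Hcz t3) as [? [? C3]],
        (Hcz t4) as [? [? C4]], (Hcz t5) as [? [? C5]], (Hcz t6) as [? [? C6]].
      apply (hexagon_count (A ++ H) x0 y0 z0 p q r); try lia.
      - apply NoDup_app; [apply HA|auto|]. intros t HtA HtH. exact (Hdis t HtH HtA).
      - intros t Ht. destruct (Hproj D0 t Ht) as [u0 [U0 <-]], (Hproj D1 t Ht) as [u1 [U1 <-]],
          (Hproj D2 t Ht) as [u2 [U2 <-]].
        repeat split; apply Hx || apply Hy || apply Hz; auto. }
    assert (Hhl : (h <= length H)%nat).
    { subst h. apply NoDup_incl_length; auto. intros t Ht. apply HH. auto. }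
    rewrite length_app in Hc.
    apply (isoperimetric_arith _ p q r) in Hc; lia.
Qed.

Lemma polyiamond_lower_bound A h k : 1 < k -> polyiamond A -> num_holes A h ->
  2 * Z.of_nat h = 3 * k * (k - 1) -> 9 * k * k + 3 * k - 4 <= 2 * Z.of_nat (length A).
Proof.
  intros Hk HA Hh Hhk. destruct (polyiamond_bound A h HA Hh) as [s [Hs [H1 H2]]].
  set (n := Z.of_nat (length A)) in *. set (g := Z.of_nat h) in *.
  destruct (Z_le_gt_dec (9 * k * k + 3 * k - 4) (2 * n)) as [|Hlt]; [auto|exfalso].
  (* [s <= n + 2 - 3 h = 6 k - j], where [n] falls short of the bound by [j > 0]. *)
  set (j := 6 * k - (n + 2 - 3 * g)).
  assert (Hj : 0 < j) by (unfold j; nia).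
  assert (Hn : n + g = 6 * k * k - 2 - j) by (unfold j; nia).
  assert (Hj' : j <= 6 * k) by (unfold j; lia).
  assert (s * s <= (6 * k - j) * (6 * k - j)) by (apply Z.square_le_mono_nonneg; unfold j; lia).
  (* The inequalities so far give [j (12 k - 6 - j) <= 12]. This product bounds [j^2] by
     [6 k j - 6 k + j], which is a contradiction for [k >= 2]. *)
  assert (0 <= (j - 1) * (6 * k - j)) by (apply Z.mul_nonneg_nonneg; lia).
  nia.
Qed.

Ltac Zify.zify_post_hook ::= Z.div_mod_to_equations.

(** * The extremal polyiamonds *)

(** The extents are [2 k + 1], [2 k - 1] and [2 k], with two corners of side [k] cut off the
    parallelogram; [hexagon 1] is the row of four tiles. *)
Definition hexagon (k : Z) (t : tri) : Prop :=
  - k <= co D1 t <= k /\ 1 - k <= co D2 t <= k - 1 /\ 1 - k <= co D0 t <= k.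

(* The ring of level [m >= 2] consists of the tiles of [hexagon m] outside
   [hexagon (m - 1)]. It contains [6 (m - 1)] tiles sharing a side with
   [hexagon (m - 1)]; every other one of them, in cyclic order, is punched.
   The six clauses are the six sides of the ring. *)
Definition punched (t : tri) : Prop :=
  let '(x, y, b) := t in
  if b then
    (0 <= y /\ 1 <= x /\ y mod 2 = 0) \/
    (1 <= y /\ y <= - x - 2 /\ (x + y) mod 2 = 1) \/
    (y <= -1 /\ 0 <= x <= - y /\ x mod 2 = 0)
  else
    (y <= -1 /\ 2 <= x + y /\ y mod 2 = 0) \/
    (1 <= y /\ - y <= x <= 0 /\ (x + y) mod 2 = 0) \/
    (y <= 0 /\ x <= -1 /\ x mod 2 = 0).

Definition kept (k : Z) (t : tri) : Prop := hexagon k t /\ ~ punched t.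

Definition punched_hexagon (k : Z) : list tri :=
  sub (kept k) (box (- k) (2 * k + 1) (1 - k) (2 * k - 1)).

Lemma in_punched_hexagon k t : In t (punched_hexagon k) <-> kept k t.
Proof.
  unfold punched_hexagon. rewrite in_sub. split; [tauto|].
  intros H. split; [|auto]. destruct H as [[Hx [Hy _]] _]. apply in_box; lia.
Qed.

Ltac tri_lia := unfold kept, hexagon, punched; cbn [co nb negb]; lia.

Definition to_center (k : Z) (t : tri) : Prop := conn (kept k) t (0, 0, false).

Lemma to_center_nb k d t : to_center k (nb d t) -> kept k t -> to_center k t.
Proof.
  intros H Hk. apply conn_sym in H. apply conn_sym.
  rewrite <- (nb_involutive d t). apply conn_nb_r; [auto|]. now rewrite nb_involutive.
Qed.

Ltac finish_path IH := cbn [nb negb]; apply IH; tri_lia.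
Ltac step d := apply (to_center_nb _ d); [cbn [nb negb]|first [assumption|tri_lia]].

(* From a kept tile of a ring one reaches, within three steps along the ring, a
   kept tile sharing a side with the previous level. *)
Lemma kept_to_center k m : 1 <= m <= k ->
  forall t, hexagon m t -> ~ punched t -> to_center k t.
Proof.
  intros [H1 Hk]. revert Hk. pattern m. apply Zlt_lower_bound_ind with (z := 1); [|lia].
  clear m H1. intros m IH0 H1 Hk.
  assert (m = 1 \/ 2 <= m) as [->|Hm] by lia.
  { intros [[x y] b] Hh Hp.
    assert (H0 : to_center k (0, 0, false)) by (apply conn_refl; tri_lia).
    assert (H2 : to_center k (0, 0, true)) by (apply (to_center_nb _ D0); [exact H0|tri_lia]).
    unfold hexagon in Hh. cbn in Hh.
    assert (y = 0) as -> by lia.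
    assert (x = -1 \/ x = 0 \/ x = 1) as [->|[->| ->]] by lia; destruct b; try lia; auto.
    - apply (to_center_nb _ D1); [exact H0|tri_lia].
    - apply (to_center_nb _ D1); [exact H2|tri_lia]. }
  assert (IH : forall t, hexagon (m - 1) t -> ~ punched t -> to_center k t)
    by (apply IH0; lia).
  clear IH0. intros t Ht Hp.
  destruct (classic (hexagon (m - 1) t)) as [Hin|Hout]; [auto|].
  destruct t as [[x y] b]. unfold hexagon in Ht, Hout.
  assert (K : kept k (x, y, b)) by (split; [unfold hexagon; lia|exact Hp]).
  (* For either orientation, the first three cases are tiles facing outwards: parity selects a kept
     neighbour along the ring, and near corners the path is longer. In the last three cases the tile
     shares a side with the previous level. *)
  destruct b; cbn [co] in *; unfold punched in Hp.
  - destruct (Z.eq_dec x m) as [Ex|Ex].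
    { clear Hout Hp. destruct (Z.eq_dec (y mod 2) 0); [step D2; step D1; finish_path IH|].
      destruct (Z.eq_dec y (1 - m)); [step D0; step D1; step D2; finish_path IH|step D0; step D1; finish_path IH]. }
    destruct (Z.eq_dec y (m - 1)) as [Ey|Ey].
    { clear Hout Hp. destruct (Z.eq_dec x (- m)).
      (* For [m = 2] the third step still ends outside the row [hexagon 1], so a fourth is
         needed. *)
      { destruct (Z.eq_dec m 2); [step D0; step D2; step D1; step D0; finish_path IH|step D0; step D2; step D1; finish_path IH]. }
      destruct (Z.eq_dec ((x + y) mod 2) 1); [step D0; step D2; finish_path IH|].
      destruct (Z.eq_dec x 0); [step D1; step D2; step D0; finish_path IH|step D1; step D2; finish_path IH]. }
    destruct (Z.eq_dec (x + y) (- m)) as [Ez|Ez].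
    { clear Hout Hp. destruct (Z.eq_dec (x mod 2) 0); [step D1; step D0; finish_path IH|].
      destruct (Z.eq_dec y 0); [step D2; step D0; step D1; finish_path IH|step D2; step D0; finish_path IH]. }
    destruct (Z.eq_dec (x + y + 1) m); [step D0; finish_path IH|].
    destruct (Z.eq_dec y (1 - m)); [step D2; finish_path IH|step D1; finish_path IH].
  - destruct (Z.eq_dec (x + y) m) as [Ez|Ez].
    { clear Hout Hp. destruct (Z.eq_dec y 0).
      { destruct (Z.eq_dec m 2); [step D2; step D0; step D1; step D2; finish_path IH|step D2; step D0; step D1; finish_path IH]. }
      destruct (Z.eq_dec (y mod 2) 0); [step D2; step D0; finish_path IH|].
      destruct (Z.eq_dec x 1); [step D1; step D0; step D2; finish_path IH|step D1; step D0; finish_path IH]. }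
    destruct (Z.eq_dec x (- m)) as [Ex|Ex].
    { clear Hout Hp. destruct (Z.eq_dec ((x + y) mod 2) 0); [step D0; step D1; finish_path IH|].
      destruct (Z.eq_dec y 1); [step D2; step D1; step D0; finish_path IH|step D2; step D1; finish_path IH]. }
    destruct (Z.eq_dec y (1 - m)) as [Ey|Ey].
    { clear Hout Hp. destruct (Z.eq_dec x 0); [step D1; step D2; step D0; finish_path IH|].
      destruct (Z.eq_dec (x mod 2) 0); [step D1; step D2; finish_path IH|].
      destruct (Z.eq_dec x m); [step D0; step D2; step D1; finish_path IH|step D0; step D2; finish_path IH]. }
    destruct (Z.eq_dec x m); [step D1; finish_path IH|].
    destruct (Z.eq_dec y (m - 1)); [step D2; finish_path IH|step D0; finish_path IH].
Qed.

Lemma polyiamond_punched_hexagon k : 1 <= k -> polyiamond (punched_hexagon k).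
Proof.
  intros Hk. split; [|split].
  - intros E. assert (H : In (0, 0, false) (punched_hexagon k)).
    { apply in_punched_hexagon. tri_lia. }
    rewrite E in H. easy.
  - apply NoDup_sub, NoDup_box.
  - intros t u Ht Hu. apply (conn_mono (kept k)); [apply in_punched_hexagon|].
    apply in_punched_hexagon in Ht, Hu.
    assert (H : forall v, kept k v -> to_center k v)
      by (intros v [? ?]; apply (kept_to_center k k); auto; lia).
    eapply conn_trans; [apply H, Ht|apply conn_sym, H, Hu].
Qed.

(** A punched tile turns one side to the previous level and two to unpunched tiles of its own ring.
    Hence it is a hole by itself. *)
Lemma nb_punched k d t : hexagon k t -> punched t -> kept k (nb d t).
Proof.
  destruct t as [[x y] b]. unfold hexagon, punched. intros Hh Hp.
  destruct b; cbn [co] in Hh; destruct Hp as [Hp|[Hp|Hp]], d; tri_lia.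
Qed.

Lemma punched_isolated k t u : hexagon k t -> punched t ->
  conn (compl (punched_hexagon k)) t u -> u = t.
Proof.
  intros Hh Hp Hc. apply (conn_invariant _ (fun v => v = t) t u) in Hc; auto.
  intros v d _ Hd ->. exfalso. apply Hd, in_punched_hexagon, nb_punched; auto.
Qed.

Lemma punched_bounded k t : hexagon k t -> punched t -> bounded_comp (punched_hexagon k) t.
Proof.
  intros Hh Hp. destruct t as [[x0 y0] b0]. exists (Z.max (Z.abs x0) (Z.abs y0)). intros x y b Hc.
  apply (punched_isolated k) in Hc; auto. inversion Hc. lia.
Qed.

(* A tile outside the hexagon lies in a strip disjoint from the hexagon. *)
Lemma outside_unbounded k t : ~ hexagon k t -> ~ bounded_comp (punched_hexagon k) t.
Proof.
  intros Hh [N HN].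
  assert (Hc : exists c d d' : dir, d <> d' /\ d <> c /\ d' <> c /\
    forall u, co c u = co c t -> ~ hexagon k u).
  { unfold hexagon in *.
    destruct (classic (- k <= co D1 t <= k)) as [H1|H1];
      [destruct (classic (1 - k <= co D2 t <= k - 1)) as [H2|H2]|].
    - exists D0, D1, D2. repeat split; try discriminate. intros u E. rewrite E. tauto.
    - exists D2, D0, D1. repeat split; try discriminate. intros u E. rewrite E. tauto.
    - exists D1, D0, D2. repeat split; try discriminate. intros u E. rewrite E. tauto. }
  destruct Hc as [c [d [d' [Hd [Hdc [Hdc' Hout]]]]]].
  destruct (zigzag_monotone d d' Hd) as [pos Hpos].
  set (A := punched_hexagon k) in *.
  assert (Hcompl : forall u, co c u = co c t -> compl A u).
  { intros u E Hin. apply in_punched_hexagon in Hin. apply (Hout u E), Hin. }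
  set (Box := box (- N) (2 * N + 1) (- N) (2 * N + 1)).
  assert (HBox : forall u, conn (compl A) t u -> In u Box).
  { intros [[x y] b] Hc. specialize (HN x y b Hc).
    apply in_box; cbn [co]; lia. }
  (* In a bounded component this strip would have a farthest tile, but a zigzag step from it stays
     in the strip and hence in the complement. *)
  destruct (exists_maximizer pos (fun u => conn (compl A) t u /\ co c u = co c t) Box)
    as [u [_ [[Hcu Ecu] Hmax]]].
  { exists t. assert (conn (compl A) t t) by (apply conn_refl; auto). auto. }
  assert (E : co c (zigzag d d' u) = co c t).
  { rewrite <- Ecu. unfold zigzag. destruct (snd u); apply co_nb_other; auto. }
  assert (Hcz : conn (compl A) t (zigzag d d' u)).
  { apply Hcompl in E. unfold zigzag in *. destruct (snd u); apply conn_nb_r; auto. }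
  specialize (Hmax _ (HBox _ Hcz) (conj Hcz E)). specialize (Hpos u). lia.
Qed.

(** * Counting the holes and the tiles *)

(* The tiles of the ring of level [m] sharing a side with the previous level,
   in cyclic order for [0 <= w < 6 (m - 1)]. *)
Definition ring_tile (m w : Z) : tri :=
  if w <=? m - 2 then (m - 1 - w, w, true)
  else if w <=? 2 * m - 2 then (m - 1 - w, m - 1, false)
  else if w <=? 3 * m - 4 then (- m, 3 * m - 3 - w, true)
  else if w <=? 4 * m - 5 then (w - 4 * m + 4, 3 * m - 3 - w, false)
  else if w <=? 5 * m - 5 then (w - 4 * m + 4, 1 - m, true)
  else (m, w - 6 * m + 6, false).

Ltac split_ring m w :=
  unfold ring_tile;
  destruct (Z.leb_spec w (m - 2)); [|destruct (Z.leb_spec w (2 * m - 2)); [|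
  destruct (Z.leb_spec w (3 * m - 4)); [|destruct (Z.leb_spec w (4 * m - 5)); [|
  destruct (Z.leb_spec w (5 * m - 5))]]]].

Lemma ring_tile_level m w : 2 <= m -> 0 <= w < 6 * (m - 1) ->
  hexagon m (ring_tile m w) /\ ~ hexagon (m - 1) (ring_tile m w).
Proof. intros Hm Hw. split_ring m w; tri_lia. Qed.

Lemma ring_tile_punched m i : 2 <= m -> 0 <= i < 3 * (m - 1) -> punched (ring_tile m (2 * i)).
Proof. intros Hm Hw. split_ring m (2 * i); tri_lia. Qed.

Lemma ring_tile_inj m w w' : 2 <= m -> 0 <= w < 6 * (m - 1) -> 0 <= w' < 6 * (m - 1) ->
  ring_tile m w = ring_tile m w' -> w = w'.
Proof.
  intros Hm Hw Hw' E.
  pose proof (f_equal (co D0) E) as E0. pose proof (f_equal (co D1) E) as E1.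
  pose proof (f_equal (co D2) E) as E2. clear E. revert E0 E1 E2.
  split_ring m w; split_ring m w'; cbn [co]; lia.
Qed.

Lemma ring_tile_surj m t : 2 <= m -> hexagon m t -> ~ hexagon (m - 1) t -> punched t ->
  exists i, 0 <= i < 3 * (m - 1) /\ t = ring_tile m (2 * i).
Proof.
  destruct t as [[x y] b]. intros Hm Hh Hn Hp.
  enough (exists w, 0 <= w < 6 * (m - 1) /\ w mod 2 = 0 /\ (x, y, b) = ring_tile m w)
    as [w [Hw [Hw2 E]]].
  { exists (w / 2). replace (2 * (w / 2)) with w by lia. split; [lia|auto]. }
  (* Each clause of [punched] is one side of the ring; [w] is solved from the matching branch of
     [ring_tile]. *)
  unfold hexagon, punched in *. destruct b; cbn [co] in *; destruct Hp as [Hp|[Hp|Hp]].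
  - exists y. split; [lia|split; [lia|]]. split_ring m y; try lia; tri_eq.
  - exists (3 * m - 3 - y). split; [lia|split; [lia|]].
    split_ring m (3 * m - 3 - y); try lia; tri_eq.
  - exists (x + 4 * m - 4). split; [lia|split; [lia|]].
    split_ring m (x + 4 * m - 4); try lia; tri_eq.
  - exists (y + 6 * m - 6). split; [lia|split; [lia|]].
    split_ring m (y + 6 * m - 6); try lia; tri_eq.
  - exists (m - 1 - x). split; [lia|split; [lia|]].
    split_ring m (m - 1 - x); try lia; tri_eq.
  - exists (3 * m - 3 - y). split; [lia|split; [lia|]].
    split_ring m (3 * m - 3 - y); try lia; tri_eq.
Qed.

(** Rings start at level 2, so [n] of them extend the central row to [hexagon (n + 1)]. *)
Fixpoint punched_tiles (n : nat) : list tri :=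
  match n with
  | O => []
  | S n' => punched_tiles n' ++
      map (fun i => ring_tile (Z.of_nat n' + 2) (2 * i)) (range 0 (3 * (Z.of_nat n' + 1)))
  end.

Lemma length_punched_tiles n :
  2 * Z.of_nat (length (punched_tiles n)) = 3 * Z.of_nat n * (Z.of_nat n + 1).
Proof.
  induction n as [|n IH]; [reflexivity|].
  cbn [punched_tiles]. rewrite length_app, length_map, length_range. nia.
Qed.

Lemma in_punched_tiles n t :
  In t (punched_tiles n) <-> hexagon (Z.of_nat n + 1) t /\ punched t.
Proof.
  induction n as [|n IH].
  - split; [easy|]. destruct t as [[x y] []]; unfold hexagon, punched; cbn [co]; lia.
  - cbn [punched_tiles]. rewrite in_app_iff, IH, in_map_iff.
    replace (Z.of_nat (S n) + 1) with (Z.of_nat n + 2) by lia.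
    set (m := Z.of_nat n + 2). replace (Z.of_nat n + 1) with (m - 1) by lia.
    assert (Hm : 2 <= m) by lia. split.
    + intros [[H1 H2]|[i [<- Hi]]].
      * split; [|auto]. unfold hexagon in *. lia.
      * apply in_range in Hi. split; [apply ring_tile_level|apply ring_tile_punched]; lia.
    + intros [H1 H2]. destruct (classic (hexagon (m - 1) t)) as [|Hn]; [auto|right].
      destruct (ring_tile_surj m t Hm H1 Hn H2) as [i [Hi E]].
      exists i. split; [auto|]. apply in_range. lia.
Qed.

Lemma NoDup_punched_tiles n : NoDup (punched_tiles n).
Proof.
  induction n as [|n IH]; [constructor|]. cbn [punched_tiles].
  apply NoDup_app; [auto| |].
  - apply NoDup_map_inj_in; [|apply NoDup_range]. intros i j Hi Hj E.
    apply in_range in Hi, Hj. apply ring_tile_inj in E; lia.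
  - intros t H1 H2. apply in_punched_tiles in H1. apply in_map_iff in H2.
    destruct H2 as [i [<- Hi]]. apply in_range in Hi.
    destruct (ring_tile_level (Z.of_nat n + 2) (2 * i)) as [_ H]; try lia.
    apply H. replace (Z.of_nat n + 2 - 1) with (Z.of_nat n + 1) by lia. apply H1.
Qed.

Lemma ForallOrdPairs_NoDup {T : Type} (R : T -> T -> Prop) l :
  (forall a b, In a l -> R a b -> b = a) -> NoDup l -> ForallOrdPairs (fun a b => ~ R a b) l.
Proof.
  intros HR HN. induction HN as [|a l Ha HN IH]; constructor.
  - apply Forall_forall. intros b Hb Hab. apply HR in Hab; [|simpl; auto]. congruence.
  - apply IH. intros; apply HR; simpl; auto.
Qed.

(** Each punched tile is a whole component and represents itself; every other missing tile lies
    outside the hexagon, in an unbounded component. *)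
Lemma num_holes_punched_hexagon n :
  num_holes (punched_hexagon (Z.of_nat n + 1)) (length (punched_tiles n)).
Proof.
  set (k := Z.of_nat n + 1). exists (punched_tiles n). split; [auto|split; [|split]].
  - intros r Hr. apply in_punched_tiles in Hr. destruct Hr as [Hh Hp].
    split; [|now apply punched_bounded].
    intros Hin. apply in_punched_hexagon in Hin. apply Hin, Hp.
  - apply ForallOrdPairs_NoDup; [|apply NoDup_punched_tiles].
    intros a b Ha. apply in_punched_tiles in Ha. apply punched_isolated; apply Ha.
  - intros t Ht Hb. exists t. split; [|now apply conn_refl].
    apply in_punched_tiles. fold k.
    assert (Hh : hexagon k t) by (apply NNPP; intros Hn; now apply (outside_unbounded k t)).
    split; [auto|]. apply NNPP. intros Hp. apply Ht, in_punched_hexagon. now split.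
Qed.

Lemma length_punched_hexagon_le n : (0 < n)%nat ->
  Z.of_nat (length (punched_hexagon (Z.of_nat n + 1))) + Z.of_nat (length (punched_tiles n)) <=
  6 * (Z.of_nat n + 1) * (Z.of_nat n + 1) - 2.
Proof.
  intros Hn. set (k := Z.of_nat n + 1). assert (Hk : 2 <= k) by lia.
  enough (H : Z.of_nat (length (punched_hexagon k ++ punched_tiles n)) + k * k + k * k <=
    2 * (2 * k + 1) * (2 * k - 1)) by (rewrite length_app in H; nia).
  apply (hexagon_count _ (- k) (1 - k) (1 - k) (2 * k + 1) (2 * k - 1) (2 * k)); try lia.
  - apply NoDup_app; [apply NoDup_sub, NoDup_box|apply NoDup_punched_tiles|].
    intros t H1 H2. apply in_punched_hexagon in H1. apply in_punched_tiles in H2.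
    apply H1, H2.
  - intros t Ht. enough (H : hexagon k t) by (unfold hexagon in H; lia).
    apply in_app_or in Ht. destruct Ht as [Ht|Ht].
    + apply in_punched_hexagon in Ht. apply Ht.
    + apply in_punched_tiles in Ht. apply Ht.
Qed.

(** * Both bounds combined *)

Open Scope nat_scope.

(* h_k = (3/2)k^2 - (3/2)k = 3k(k-1)/2 and n_k = (9/2)k^2 + (3/2)k - 2
   = (9k^2 + 3k - 4)/2; both divisions are exact (numerators even). *)
Theorem theorem1 : forall k : nat, 1 < k ->
  g_triangle_eq (3 * k * (k - 1) / 2) ((9 * k * k + 3 * k - 4) / 2).
Proof.
  intros k Hk.
  assert (Hh : length (punched_tiles (k - 1)) = 3 * k * (k - 1) / 2).
  { pose proof (length_punched_tiles (k - 1)) as H.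
    apply Nat.div_unique with 0; nia. }
  assert (Hn : forall a, (9 * Z.of_nat k * Z.of_nat k + 3 * Z.of_nat k - 4 <= 2 * Z.of_nat a)%Z ->
    (9 * k * k + 3 * k - 4) / 2 <= a).
  { intros a Ha. apply Nat.Div0.div_le_upper_bound. nia. }
  assert (Hlow : forall A, polyiamond A -> num_holes A (3 * k * (k - 1) / 2) ->
    (9 * Z.of_nat k * Z.of_nat k + 3 * Z.of_nat k - 4 <= 2 * Z.of_nat (length A))%Z).
  { intros A HA HhA. apply (polyiamond_lower_bound A _ (Z.of_nat k) ltac:(lia) HA HhA).
    rewrite <- Hh, length_punched_tiles. nia. }
  split; [|intros A HA HhA; apply Hn, Hlow; auto].
  pose proof (length_punched_hexagon_le (k - 1) ltac:(lia)) as Hle.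
  pose proof (length_punched_tiles (k - 1)) as Hlen.
  pose proof (num_holes_punched_hexagon (k - 1)) as Hnum. rewrite Hh in Hnum.
  replace (Z.of_nat (k - 1) + 1)%Z with (Z.of_nat k) in * by lia.
  assert (HA : polyiamond (punched_hexagon (Z.of_nat k)))
    by (apply polyiamond_punched_hexagon; lia).
  exists (punched_hexagon (Z.of_nat k)). split; [auto|split; [auto|]].
  (* The lower bound, applied to the example itself, turns the estimate [Hle] of its size into an
     equality. *)
  specialize (Hlow _ HA Hnum). unfold card.
  apply Nat.div_unique with 0; nia.
Qed.
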